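(* Let $A$ be a finitely generated abelian group and let $G$ be a non-torsion group which is self-similar and finite-state with respect to some simple $G$-data. Then the restricted wreath product $A\wr G$ is isomorphic to a subgroup of $\mathcal F_n$ for some $n\ge2$; equivalently, $A\wr G$ is a subgroup of an automata group.
   Context: For $m\ge2$, $\mathcal T_m$ is the one-rooted $m$-regular tree with vertices the finite words over $\{1,\dots,m\}$, $\mathcal A_m$ its automorphism group, each $\alpha\in\mathcal A_m$ written $\alpha=(\alpha_1,\dots,\alpha_m)\sigma(\alpha)$ with $\sigma(\alpha)\in S_m$ the first-level action and $\alpha_i$ the states; $Q(\alpha)=\{\alpha\}\cup\bigcup_iQ(\alpha_i)$, $\alpha$ is finite-state if $Q(\alpha)$ is finite, and $\mathcal F_m$ is the group of finite-state automorphisms. A subgroup $G\le \mathcal A_m$ is self-similar if $Q(\alpha)\subseteq G$ for all $\alpha\in G$; an automata group is a finitely generated self-similar subgroup of some $\mathcal F_m$. Conventions: maps written on the right. A virtual endomorphism of $G$ is a homomorphism $f:H\to G$ from a finite-index subgroup. A $G$-data $(\mathbf m,\mathbf H,\mathbf F)$ consists of subgroups $H_1,\dots,H_s$ with $[G:H_i]=m_i$, $\mathbf m=(m_1,\dots,m_s)$, $m=\sum m_i$, and virtual endomorphisms $f_i:H_i\to G$. Choosing right transversals $T_i$ of $H_i$, with $\theta_i(g,t)=tg(t')^{-1}$ where $H_it'=H_itg$ and $g^\sigma$ the permutation $t\mapsto t'$ of $T_1\sqcup\dots\sqcup T_s\cong\{1,\dots,m\}$, the data induces $\varphi:G\to\mathcal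 A_m$, $g^\varphi=((\theta_i(g,t)^{f_i})^\varphi\mid t\in T_i,1\le i\le s)\,g^\sigma$, whose kernel is the $\mathbf F$-core: the largest subgroup of $\bigcap_iH_i$ normal in $G$ and $f_i$-invariant for all $i$. The data is simple if the $\mathbf F$-core is trivial; $G$ is finite-state with respect to a simple data if for some choice of transversals $G^\varphi\le\mathcal F_m$. *)

(* Defs.v *)
From Stdlib Require List.
From mathcomp Require Import all_boot all_order all_algebra.
Set Implicit Arguments. Unset Strict Implicit. Unset Printing Implicit Defensive.
Import GRing.Theory.
Local Open Scope ring_scope.

Record is_group (G : Type) (mul : G -> G -> G) (one : G) (inv : G -> G) : Prop := {
  grp_assoc : forall x y z, mul x (mul y z) = mul (mul x y) z;
  grp_mul1g : forall x, mul one x = x;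
  grp_mulg1 : forall x, mul x one = x;
  grp_mulVg : forall x, mul (inv x) x = one;
  grp_mulgV : forall x, mul x (inv x) = one }.

Definition gpow (G : Type) (mul : G -> G -> G) (one : G) (g : G) (n : nat) : G :=
  iter n (mul g) one.

Definition non_torsion (G : Type) (mul : G -> G -> G) (one : G) : Prop :=
  exists g : G, forall n : nat, (0 < n)%N -> gpow mul one g n <> one.

Definition is_subgroup (G : Type) (mul : G -> G -> G) (one : G) (inv : G -> G)
  (K : G -> Prop) : Prop :=
  K one /\ (forall x y, K x -> K y -> K (mul x y)) /\ (forall x, K x -> K (inv x)).

Definition fin_gen_zmod (A : zmodType) : Prop :=
  exists s : seq A, forall a : A, exists z : seq int,
    size z = size s /\ a = \sum_(i < size s) (s`_i *~ z`_i).

Definition is_child (X : Type) (u v : seq X) : Prop := exists x : X, v = rcons u x.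

Definition is_tree_aut (X : finType) (a : seq X -> seq X) : Prop :=
  a [::] = [::] /\ bijective a /\
  (forall u v : seq X, is_child u v <-> is_child (a u) (a v)).

(* section (state) of a at vertex u: (u w)^a = u^a w^(a_u) *)
Definition state (X : finType) (a : seq X -> seq X) (u : seq X) : seq X -> seq X :=
  fun w => drop (size u) (a (u ++ w)).

Definition finite_state (X : finType) (a : seq X -> seq X) : Prop :=
  exists L : seq (seq X -> seq X), forall u : seq X,
    exists2 b, List.In b L & state a u =1 b.

Definition in_F (X : finType) (a : seq X -> seq X) : Prop :=
  is_tree_aut a /\ finite_state a.

(* Alphabet: disjoint union T_1 |_| ... |_| T_s, with T_i indexed by 'I_(ms i). *)
Definition dletter (s : nat) (ms : 'I_s -> nat) : finType := {i : 'I_s & 'I_(ms i)}.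

(* g^phi acting on words: (t w)^(g^phi) = t^(g^sigma) w^((theta_i(g,t)^{f_i})^phi) *)
Fixpoint dact (G : Type) (mul : G -> G -> G) (inv : G -> G)
  (s : nat) (ms : 'I_s -> nat) (f : 'I_s -> G -> G)
  (T : forall i : 'I_s, 'I_(ms i) -> G) (r : forall i : 'I_s, G -> 'I_(ms i))
  (g : G) (w : seq (dletter ms)) {struct w} : seq (dletter ms) :=
  match w with
  | [::] => [::]
  | x :: w' =>
      let i := tag x in
      let tg := mul (T i (tagged x)) g in
      let k := r i tg in
      (existT (fun i0 : 'I_s => 'I_(ms i0)) i k)
        :: dact mul inv f T r (f i (mul tg (inv (T i k)))) w'
  end.

(* (H, f, T, r) is a G-data with right transversals T_i (r_i g = index of coset H_i g) *)
Definition is_Gdata (G : Type) (mul : G -> G -> G) (one : G) (inv : G -> G)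
  (s : nat) (ms : 'I_s -> nat) (H : 'I_s -> G -> Prop) (f : 'I_s -> G -> G)
  (T : forall i : 'I_s, 'I_(ms i) -> G) (r : forall i : 'I_s, G -> 'I_(ms i)) : Prop :=
  (forall i, is_subgroup mul one inv (H i)) /\
  (forall i x y, H i x -> H i y -> f i (mul x y) = mul (f i x) (f i y)) /\
  (forall i g, H i (mul g (inv (T i (r i g))))) /\
  (forall i g k, H i (mul g (inv (T i k))) -> k = r i g).

(* simple: the F-core (largest subgroup of /\_i H_i, normal in G, f_i-invariant
   for all i) is trivial, i.e. every such subgroup is trivial *)
Definition simple_data (G : Type) (mul : G -> G -> G) (one : G) (inv : G -> G)
  (s : nat) (H : 'I_s -> G -> Prop) (f : 'I_s -> G -> G) : Prop :=
  forall K : G -> Prop,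
    is_subgroup mul one inv K ->
    (forall x, K x -> forall i, H i x) ->
    (forall x g, K x -> K (mul (inv g) (mul x g))) ->
    (forall i x, K x -> K (f i x)) ->
    forall x, K x -> x = one.

Definition ss_finite_state_simple (G : Type) (mul : G -> G -> G) (one : G)
  (inv : G -> G) : Prop :=
  exists (s : nat) (ms : 'I_s -> nat) (H : 'I_s -> G -> Prop) (f : 'I_s -> G -> G)
         (T : forall i : 'I_s, 'I_(ms i) -> G) (r : forall i : 'I_s, G -> 'I_(ms i)),
    is_Gdata mul one inv H f T r /\ simple_data mul one inv H f /\
    (forall g : G, in_F (dact mul inv f T r g)) /\
    (forall (g : G) (u : seq (dletter ms)),
        exists h : G, state (dact mul inv f T r g) u =1 dact mul inv f T r h).

Definition finsupp (A : zmodType) (G : Type) (phi : G -> A) : Prop :=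
  exists l : seq G, forall x : G, phi x != 0 -> List.In x l.

(* (phi1, g1)(phi2, g2) = (phi1 + g1.phi2, g1 g2) with (g.phi)(x) = phi(g^-1 x) *)
Definition wr_mulf (A : zmodType) (G : Type) (mul : G -> G -> G) (inv : G -> G)
  (phi1 : G -> A) (g1 : G) (phi2 : G -> A) : G -> A :=
  fun x => phi1 x + phi2 (mul (inv g1) x).

(* A wr G is isomorphic to a subgroup of F_n (maps on the right: w^(ab) = (w^a)^b) *)
Definition wreath_embeds_in_F (A : zmodType) (G : Type) (mul : G -> G -> G)
  (inv : G -> G) (n : nat) : Prop :=
  exists psi : (G -> A) -> G -> seq 'I_n -> seq 'I_n,
    (forall phi g, finsupp phi -> in_F (psi phi g)) /\
    (forall phi1 g1 phi2 g2, finsupp phi1 -> finsupp phi2 ->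
       psi (wr_mulf mul inv phi1 g1 phi2) (mul g1 g2)
         =1 (fun w => psi phi2 g2 (psi phi1 g1 w))) /\
    (forall phi1 g1 phi2 g2, finsupp phi1 -> finsupp phi2 ->
       psi phi1 g1 =1 psi phi2 g2 -> phi1 =1 phi2 /\ g1 = g2).

(* Main.v *)
(* Let X be the alphabet on which G acts.  The embedding of A wr G acts on words
   over three kinds of letters: queries (x, y), where x is moved by g and y is a
   guess left fixed; resets, after which g acts afresh from its initial state; and
   digits, on which A acts by odometers.  While reading queries, (phi, g) runs all
   h in the support of phi in parallel and discards h as soon as h sends some x to
   a letter different from the guess y; the digits then see the sum of phi over
   the surviving h.  Since phi has finite support and G is finite-state, this needs
   finitely many states; since G acts faithfully, finitely many queries separated
   by resets isolate any given h0 in the support, so phi can be read off.  For A,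
   finitely many maps to Z/d (d >= 0) separate its points; Z acts by the binary
   odometer and Z/d, d > 0, by rotating the first digit. *)
Require Import Defs.
From mathcomp Require Import all_boot all_order all_algebra.
From mathcomp Require Import boolp classical_sets fsbigop.
From mathcomp Require Import zify ring.
Set Implicit Arguments. Unset Strict Implicit. Unset Printing Implicit Defensive.
Import Order.TTheory GRing.Theory Num.Theory.
Local Open Scope ring_scope.

(** * Mealy machines *)

Section Mealy.
Variables (S : Type) (Z : finType) (out : S -> Z -> Z) (nxt : S -> Z -> S).

Fixpoint run (s : S) (w : seq Z) : seq Z :=
  if w is x :: w' then out s x :: run (nxt s x) w' else [::].

Definition reach (s : S) (u : seq Z) : S := foldl nxt s u.

Lemma size_run s w : size (run s w) = size w.
Proof. by elim: w s => //= x w IH s; rewrite IH. Qed.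

Lemma run_cat s u w : run s (u ++ w) = run s u ++ run (reach s u) w.
Proof. by elim: u s => //= x u IH s; rewrite IH. Qed.

Lemma state_run s u : state (run s) u =1 run (reach s u).
Proof. by move=> w; rewrite /state run_cat -(size_run s u) drop_size_cat. Qed.

Hypothesis out_inj : forall s, injective (out s).

Fixpoint run_inv (s : S) (w : seq Z) : seq Z :=
  if w is y :: w' then
    let x := invF (@out_inj s) y in x :: run_inv (nxt s x) w'
  else [::].

Lemma run_invK s : cancel (run s) (run_inv s).
Proof. by move=> w; elim: w s => //= x w IH s; rewrite invF_f IH. Qed.

Lemma runK_inv s : cancel (run_inv s) (run s).
Proof. by move=> w; elim: w s => //= x w IH s; rewrite f_invF IH. Qed.

Lemma tree_aut_run s : is_tree_aut (run s).
Proof.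
split=> //; split; first by exists (run_inv s); [exact: run_invK | exact: runK_inv].
move=> u v; split=> [[x ->]|[y]].
  by exists (out (reach s u) x); rewrite -!cats1 run_cat.
case/lastP: v => [|v x]; first by move/(congr1 size); rewrite size_rcons.
rewrite -!cats1 run_cat !cats1 => /rcons_inj[/(can_inj (run_invK s)) <- _].
by exists x.
Qed.

(** [P] is an invariant of the states reachable from [s]. States are counted only up to equal
    action, because the machine used later carries functions on an infinite group in its states. *)
Lemma in_F_run s (P : S -> Prop) (L : seq S) :
    P s -> (forall t x, P t -> P (nxt t x)) ->
    (forall t, P t -> exists2 t', List.In t' L & run t =1 run t') ->
  in_F (run s).
Proof.
move=> Ps Pn PL; split; first exact: tree_aut_run.
exists (List.map run L) => u.
have /PL[t' Lt' E] : P (reach s u) by elim: u s Ps => //= x u IH s /Pn /IH.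
exists (run t'); first exact: List.in_map.
by move=> w; rewrite state_run E.
Qed.

End Mealy.

(** * Transport of a machine to the alphabet ['I_n] *)

Section Recode.
Variables (S : Type) (Z : finType) (out : S -> Z -> Z) (nxt : S -> Z -> S).

Definition out_rank (s : S) (i : 'I_#|Z|) : 'I_#|Z| :=
  enum_rank (out s (enum_val i)).
Definition nxt_rank (s : S) (i : 'I_#|Z|) : S := nxt s (enum_val i).

Lemma run_rankE s w :
  run out_rank nxt_rank s w = map enum_rank (run out nxt s (map enum_val w)).
Proof. by elim: w s => //= i w IH s; rewrite IH. Qed.

Lemma run_rank_inj s t :
  run out_rank nxt_rank s =1 run out_rank nxt_rank t ->
  run out nxt s =1 run out nxt t.
Proof.
move=> E w; have := E (map enum_rank w); rewrite !run_rankE -map_comp.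
rewrite (eq_map (g := id)) ?map_id => [|x]; last exact: enum_rankK.
by move/inj_map; apply; apply: enum_rank_inj.
Qed.

Lemma out_rank_inj s : injective (out s) -> injective (out_rank s).
Proof. by move=> inj i j /enum_rank_inj/inj/enum_val_inj. Qed.

End Recode.

(** Asking for agreement on [s] alone keeps the list finite even when [I] is infinite; [c0] supplies
    the values off [s]. It is used to count trackers and odometer states. *)
Lemma finite_fun_choice (I : eqType) (V : Type) (R : I -> seq V) (c0 : I -> V)
    (s : seq I) :
  exists L : seq (I -> V), forall c,
    (forall i, List.In (c i) (R i)) ->
    exists2 c', List.In c' L & {in s, c =1 c'}.
Proof.
elim: s => [|i s [L HL]]; first by exists [:: c0] => c _; exists c0; [left|].
exists (List.flat_map (fun c' =>
  List.map (fun v j => if j == i then v else c' j) (R i)) L) => c cR.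
have [c' Lc' E] := HL c cR.
exists (fun j => if j == i then c i else c' j).
  apply/List.in_flat_map; exists c'; split=> //.
  apply/List.in_map_iff; by exists (c i).
move=> j; rewrite inE; case: eqVneq => [-> //|_ /=]; exact: E.
Qed.

(** * Finitely generated abelian groups *)

Definition zsubgroup (V : zmodType) (N : V -> Prop) : Prop :=
  N 0 /\ (forall x y, N x -> N y -> N (x - y)).

Lemma zsubgroupZ (V : zmodType) (N : V -> Prop) x (k : int) :
  zsubgroup N -> N x -> N (x *~ k).
Proof.
move=> [N0 NB] Nx.
have NN y : N y -> N (- y) by move=> Ny; rewrite -[- y]add0r; apply: NB.
have Nn n : N (x *+ n).
  elim: n => [|n IH]; first by rewrite mulr0n.
  by have := NB _ _ IH (NN _ Nx); rewrite opprK -mulrSr.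
case: k => n; first by rewrite -pmulrn.
by rewrite NegzE mulrNz -pmulrn; apply/NN.
Qed.

Lemma int_subgroup (N : int -> Prop) : zsubgroup N ->
  exists q : nat, forall c, N c <-> (q%:Z %| c)%Z.
Proof.
move=> NS; have [N0 NB] := NS.
have NN y : N y -> N (- y) by move=> Ny; rewrite -[- y]add0r; apply: NB.
have [exN|noN] := pselect (exists n : nat, (0 < n)%N && `[< N n%:Z >]).
  case: (ex_minnP exN) => q /andP[q0 /asboolP Nq] qmin.
  have NZ k : N (k * q%:Z) by rewrite mulrC -mulrzz; apply: zsubgroupZ.
  exists q => c; split; last by case/dvdzP=> k ->.
  move=> Nc; have cE := divz_eq c q%:Z.
  have r0 : 0 <= (c %% q%:Z)%Z by apply: modz_ge0; lia.
  have rq : (c %% q%:Z)%Z < q%:Z by apply: ltz_pmod.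
  move: cE r0 rq; set r := (c %% q%:Z)%Z; set k := (c %/ q%:Z)%Z => cE r0 rq.
  have Nr : N r by have -> : r = c - k * q%:Z; [rewrite cE; ring | apply: NB].
  have [rp|rn] := ltrP 0 r; last by apply/dvdz_mod0P; rewrite -/r; lia.
  have: (q <= `|r|)%N.
    by apply: qmin; apply/andP; split; [lia | apply/asboolP; rewrite gtz0_abs].
  lia.
exists 0%N => c; split=> [Nc|]; last by rewrite dvd0z => /eqP->.
rewrite dvd0z; apply/eqP; apply: contra_notP noN => c0.
exists `|c|%N; apply/andP; split; first lia.
by apply/asboolP; case: (ltrP 0 c) => cp; [rewrite gtz0_abs | rewrite lez0_abs //; apply: NN].
Qed.

(** A modulus 0 turns a congruence into an equation. Applied to the relations of a presentation of A
    by a free abelian group, this yields maps to cyclic groups that separate the points of A,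
    without splitting A into cyclic factors. *)
Definition congruence_cut (V : zmodType) : Prop :=
  forall N : V -> Prop, zsubgroup N ->
  exists (J : finType) (d : J -> nat) (l : J -> V -> int),
    (forall j x y, l j (x - y) = l j x - l j y) /\
    (forall v, N v <-> forall j, ((d j)%:Z %| l j v)%Z).

(** A subgroup N is determined by its projection to the first factor, generated by some q, by its
    slice over 0, and by one element (q, w) of N above the generator. *)
Lemma congruence_cut_int_prod (V : zmodType) :
  congruence_cut V -> congruence_cut (int * V)%type.
Proof.
move=> HV N NS; have [N0 NB] := NS.
have subE (x y : int * V) : x - y = (x.1 - y.1, x.2 - y.2) by [].
have NZ x k : N x -> N (x *~ k) by exact: zsubgroupZ.
have [|q qP] := @int_subgroup (fun c => exists v, N (c, v)).
  split; first by exists 0.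
  by move=> c c' [v Nv] [v' Nv']; exists (v - v'); apply: NB Nv Nv'.
have [|J [d [l [lB lN]]]] := HV (fun v => N (0, v)).
  by split=> // x y Nx Ny; have := NB _ _ Nx Ny.
(* p is q, replaced by 1 when q = 0 so that one can divide by it. *)
have [p [w [p0 qp Nw]]] : exists (p : nat) w, [/\ (0 < p)%N,
    (forall c : int, (q%:Z %| c)%Z -> (p%:Z %| c)%Z) &
    (forall c : int, (q%:Z %| c)%Z -> N (c, w *~ (c %/ p%:Z)%Z))].
  case: (posnP q) => [q0|q0].
    exists 1%N, 0; split=> // c; rewrite q0 dvd0z => /eqP->.
    by rewrite mul0rz.
  have /qP[w Nw] := dvdzz q%:Z.
  exists q, w; split=> // c /dvdzP[k ->]; rewrite mulzK; last lia.
  have -> : (k * q%:Z, w *~ k) = (q%:Z, w) *~ k; last exact: NZ.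
  rewrite [RHS]surjective_pairing (raddfMz fst) (raddfMz snd) /=.
  by rewrite mulrzz mulrC.
(* (c, v) is in N iff q | c and v - (c / p) w is in the slice of N at 0; scaling
   the forms by p makes the latter condition integral. *)
exists (option J), (fun j => if j is Some j' then (p * d j')%N else q).
exists (fun j x => if j is Some j' then p%:Z * l j' x.2 - x.1 * l j' w else x.1).
split=> [[j|] [x1 x2] [y1 y2]|[c v]] //=; first by rewrite lB; ring.
have l0 j : l j 0 = 0 by rewrite -[X in l j X](subrr 0) lB subrr.
have lD j x y : l j (x + y) = l j x + l j y.
  by rewrite -[y in LHS]opprK lB -[- y]add0r lB l0; ring.
have lZ j x k : l j (x *~ k) = k * l j x.
  suff : forall n : nat, l j (x *+ n) = n%:Z * l j x.
    move=> H; case: k => n; first by rewrite -pmulrn H.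
    rewrite NegzE mulrNz -pmulrn -[- (x *+ _)]add0r lB H l0.
    by ring.
  elim=> [|n IH]; first by rewrite mulr0n l0 mul0r.
  by rewrite mulrSr lD IH -addn1 PoszD; ring.
have split_cv : (q%:Z %| c)%Z ->
    N (c, v) <-> forall j, ((p * d j)%N%:Z %| p%:Z * l j v - c * l j w)%Z.
  move=> qc; have /dvdzP[k ck] := qp c qc.
  have kE : (c %/ p%:Z)%Z = k by rewrite ck mulzK; lia.
  have Nk := Nw c qc; rewrite kE in Nk.
  have -> : N (c, v) <-> N (0, v - w *~ k).
    split=> H.
      by have := NB _ _ H Nk; rewrite subE /= subrr.
    by have := NB _ _ H (NB _ _ N0 Nk); rewrite !subE /= !sub0r !opprK subrK.
  rewrite lN; split=> H j; have := H j; rewrite lB lZ ck.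
    have -> : p%:Z * l j v - k * p%:Z * l j w = p%:Z * (l j v - k * l j w) by ring.
    by rewrite PoszM dvdz_mul2l //; lia.
  have -> : p%:Z * l j v - k * p%:Z * l j w = p%:Z * (l j v - k * l j w) by ring.
  by rewrite PoszM dvdz_mul2l //; lia.
split=> [Ncv|H].
  have qc : (q%:Z %| c)%Z by apply/qP; exists v.
  by case=> [j|] //; move/(split_cv qc): Ncv; apply.
have qc := H None; apply/(split_cv qc) => j; exact: H (Some j).
Qed.

(** [V] is a free abelian group with one generator per entry of [s], built one factor at a time so
    that [congruence_cut_int_prod] applies; row vectors of length 0 serve as the trivial group. *)
Lemma fg_presentation (A : zmodType) (s : seq A) :
  exists (V : zmodType) (p : V -> A), [/\ congruence_cut V,
    forall x y, p (x - y) = p x - p y &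
    forall z : seq int, size z = size s ->
      exists v, p v = \sum_(i < size s) (s`_i *~ z`_i)].
Proof.
elim: s => [|a s [V [p [HV pB pz]]]].
  exists 'rV[int]_0, (fun=> 0); split=> [N [N0 _]|x y|z _]; last 2 first.
  - by rewrite subr0.
  - by exists 0; rewrite big_ord0.
  exists void, (fun=> 0%N), (fun _ _ => 0); split=> // v.
  by rewrite [v]thinmx0; split.
exists (int * V)%type, (fun v => a *~ v.1 + p v.2); split.
- exact: congruence_cut_int_prod.
- by move=> [x1 x2] [y1 y2] /=; rewrite pB mulrzBr opprD addrACA.
case=> // k z [/pz[v pv]]; exists (k, v).
by rewrite big_ord_recl /= pv.
Qed.

(** Each [chi _ j] is a linear form composed with a set-theoretic section of the presentation. The
    section is additive only up to relations, and on these the form is divisible by [d j]; hence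
    additivity modulo [d j]. *)
Lemma fin_gen_separated (A : zmodType) : fin_gen_zmod A ->
  exists (J : finType) (d : J -> nat) (chi : A -> J -> int),
    (forall a b j, ((d j)%:Z %| chi (a + b) j - (chi a j + chi b j))%Z) /\
    (forall a b, (forall j, ((d j)%:Z %| chi a j - chi b j)%Z) -> a = b).
Proof.
move=> [s sP]; have [V [p [HV pB pz]]] := fg_presentation s.
have /choice[v vP] : forall a, exists v, p v = a.
  by move=> a; have [z [/pz[v pv] ->]] := sP a; exists v.
have [|J [d [l [lB lN]]]] := HV (fun v => p v = 0).
  split=> [|x y p0 q0]; last by rewrite pB p0 q0 subrr.
  by rewrite -[X in p X](subrr 0) pB subrr.
exists J, d, (fun a j => l j (v a)); split=> [a b j|a b H]; last first.
  apply/eqP; rewrite -subr_eq0 -[a]vP -[b]vP -pB; apply/eqP/lN => j.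
  by rewrite lB.
have -> : l j (v (a + b)) - (l j (v a) + l j (v b)) = l j (v (a + b) - v a - v b).
  by rewrite !lB; ring.
by move: j; apply/lN; rewrite !pB !vP; rewrite -addrA -opprD subrr.
Qed.

(** * Odometers *)

Section Odometer.
Variables (J : finType) (d : J -> nat).

(* The modulus d j = 0 stands for Z, acting as the binary odometer. *)
Definition obase (j : J) : nat := if d j == 0 then 2 else d j.
Definition digit : finType := {j : J & 'I_(obase j)}.

(** Since [x] witnesses b > 0, the remainder is always below b and the default of [insubd] is never
    returned. *)
Definition rotate (b : nat) (n : int) (x : 'I_b) : 'I_b :=
  insubd x `|(((x : nat)%:Z + n) %% b)%Z|%N.

Definition odo_out (v : J -> int) (l : digit) : digit :=
  Tagged (fun j => 'I_(obase j)) (rotate (v (tag l)) (tagged l)).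

(** Every j has its own odometer, which digits of other indices leave alone. For [d j = 0] the
    quotient is the carry to the next digit of index j; for [d j > 0] the first digit of index j
    uses up the value. *)
Definition odo_nxt (v : J -> int) (l : digit) : J -> int := fun j =>
  if j == tag l then
    if d j == 0 then (((tagged l : nat)%:Z + v j) %/ 2)%Z else 0
  else v j.

Lemma rotateE b n (x : 'I_b) :
  (rotate n x : nat)%:Z = (((x : nat)%:Z + n) %% b)%Z.
Proof.
have b0 : 0 < b%:Z by have := ltn_ord x; lia.
have r0 : 0 <= (((x : nat)%:Z + n) %% b)%Z by apply: modz_ge0; lia.
have rb := ltz_pmod ((x : nat)%:Z + n) b0.
by rewrite val_insubd ifT ?gez0_abs //; lia.
Qed.

Lemma rotate_inj b n : injective (@rotate b n).
Proof.
move=> x y /(congr1 (fun z : 'I_b => (z : nat)%:Z)); rewrite !rotateE.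
move/eqP; rewrite eqz_modDr => /eqP.
rewrite !modz_small; try by apply/andP; split=> //; exact: ltn_ord.
by case=> /val_inj.
Qed.

Lemma odo_out_inj v : injective (odo_out v).
Proof.
move=> [i x] [j y] E; have ij : i = j := congr1 tag E.
by case: _ / ij y E => y /eqP; rewrite /odo_out eq_Tagged => /eqP /= /rotate_inj /= ->.
Qed.

Lemma odo_outD (v v1 v2 : J -> int) l :
    (forall j, ((d j)%:Z %| v j - (v1 j + v2 j))%Z) ->
  odo_out v l = odo_out v2 (odo_out v1 l).
Proof.
move=> H; rewrite /odo_out /=; congr Tagged.
apply: val_inj; apply/(can_inj (fun n : nat => erefl (`|n%:Z|%N))).
rewrite !rotateE modzDml -addrA; apply/eqP; rewrite eqz_modDl eqz_mod_dvd.
have := H (tag l); rewrite /obase; case: eqP => // ->.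
by rewrite dvd0z subr_eq0 => /eqP->; rewrite ?subrr dvdz0.
Qed.

(** For modulus 0 this is the rule for carries: adding a + b to x at once carries as much as adding
    a to x and then b to the digit left by the first addition. *)
Lemma odo_nxtD (v v1 v2 : J -> int) l :
    (forall j, ((d j)%:Z %| v j - (v1 j + v2 j))%Z) ->
  forall j, ((d j)%:Z %|
    odo_nxt v l j - (odo_nxt v1 l j + odo_nxt v2 (odo_out v1 l) j))%Z.
Proof.
move=> H k; rewrite /odo_nxt /=; case: eqVneq => [->|_]; last exact: H.
case: eqVneq (H (tag l)) => [dj0|_ _]; last by rewrite ?addr0 ?subrr dvdz0.
have obE : (obase (tag l))%:Z = 2 by rewrite /obase dj0.
rewrite rotateE obE dj0 !dvd0z !subr_eq0 => /eqP->.
rewrite addrA.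
by set x := Posz _; set a := v1 _; set b := v2 _; apply/eqP; lia.
Qed.

Lemma odo_run_inj (v v' : J -> int) :
    run odo_out odo_nxt v =1 run odo_out odo_nxt v' ->
  forall j, ((d j)%:Z %| v j - v' j)%Z.
Proof.
move=> E j.
have obase_gt0 : (0 < obase j)%N by rewrite /obase; case: eqP => // /eqP; lia.
pose l : digit := Tagged (fun j => 'I_(obase j)) (Ordinal obase_gt0).
(* Equal action on the digit 0 gives equal parity, and halving shrinks the gap. *)
have [n] := ubnP `|(v j - v' j)%R|%N; elim: n v v' E => // n IH v v' E ltn.
have rot0 : (v j %% obase j)%Z = (v' j %% obase j)%Z.
  have [/eqP] := E [:: l]; rewrite eq_Tagged => /eqP/(congr1 (fun z : 'I__ => (z : nat)%:Z)).
  by rewrite !rotateE /= !add0r.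
case: (eqVneq (d j) 0%N) => [dj0|dj0]; last first.
  by move/eqP: rot0; rewrite eqz_mod_dvd /obase (negbTE dj0).
rewrite dj0 dvd0z; rewrite /obase dj0 eqxx in rot0.
have [//|nz] := eqVneq; exfalso.
have nxtE u : odo_nxt u l j = (u j %/ 2)%Z by rewrite /odo_nxt eqxx dj0 eqxx add0r.
have := IH (odo_nxt v l) (odo_nxt v' l); rewrite !nxtE dj0 dvd0z.
have lt' : (`|(v j %/ 2)%Z - (v' j %/ 2)%Z| < n)%N by lia.
have E' : run odo_out odo_nxt (odo_nxt v l) =1 run odo_out odo_nxt (odo_nxt v' l).
  by move=> w; have [] := E (l :: w).
by move/(_ E' lt'); lia.
Qed.

(** For x in {0, 1}, the carry (x + n) div 2 is at most |n| in absolute value. Hence an odometer has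
    only finitely many states. *)
Lemma odo_nxt_bound (C : nat) v l :
  (forall j, `|v j|%N <= C)%N -> (forall j, `|odo_nxt v l j|%N <= C)%N.
Proof.
move=> H j; rewrite /odo_nxt; case: (altP eqP) => // ->.
case: eqP => // d0; have := ltn_ord (tagged l).
have ob : obase (tag l) = 2%N by rewrite /obase d0.
rewrite [X in (_ < X)%N]ob.
by have := H (tag l); lia.
Qed.

End Odometer.

(** * The machine of a simple G-data *)

Section DataMachine.
Variables (G : Type) (mul : G -> G -> G) (one : G) (inv : G -> G).
Hypothesis gG : is_group mul one inv.

Let mulA := grp_assoc gG.
Let mul1 := grp_mul1g gG.
Let mulg1 := grp_mulg1 gG.
Let mulV := grp_mulVg gG.
Let mulgV := grp_mulgV gG.

Lemma grp_mulKV x y : mul (mul x (inv y)) y = x.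
Proof. by rewrite -mulA mulV mulg1. Qed.

Lemma grp_mulK x y : mul (mul x y) (inv y) = x.
Proof. by rewrite -mulA mulgV mulg1. Qed.

Lemma grp_mulVK x y : mul (inv x) (mul x y) = y.
Proof. by rewrite mulA mulV mul1. Qed.

Lemma grp_mulKVl x y : mul x (mul (inv x) y) = y.
Proof. by rewrite mulA mulgV mul1. Qed.

Variables (s : nat) (ms : 'I_s -> nat) (H : 'I_s -> G -> Prop)
  (f : 'I_s -> G -> G) (T : forall i : 'I_s, 'I_(ms i) -> G)
  (r : forall i : 'I_s, G -> 'I_(ms i)).
Hypothesis Gdata : is_Gdata mul one inv H f T r.

Definition data_out (g : G) (x : dletter ms) : dletter ms :=
  existT (fun i : 'I_s => 'I_(ms i)) (tag x)
    (r (tag x) (mul (T (tagged x)) g)).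

Definition data_nxt (g : G) (x : dletter ms) : G :=
  let tg := mul (T (tagged x)) g in f (tag x) (mul tg (inv (T (r (tag x) tg)))).

Lemma dactE g w : dact mul inv f T r g w = run data_out data_nxt g w.
Proof. by elim: w g => //= x w IH g; rewrite IH. Qed.

Let Hr i g : H i (mul g (inv (T (r i g)))).
Proof. by case: Gdata => _ [_ []]. Qed.

Let r_uniq i g k : H i (mul g (inv (T k))) -> k = r i g.
Proof. by case: Gdata => _ [_ [_]]; apply. Qed.

Let HM i x y : H i x -> H i y -> H i (mul x y).
Proof. by case: Gdata => /(_ i)[_ [HH _]] _; apply: HH. Qed.

Let H1 i : H i one.
Proof. by case: Gdata => /(_ i)[]. Qed.

Let fM i x y : H i x -> H i y -> f i (mul x y) = mul (f i x) (f i y).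
Proof. by case: Gdata => _ [HH _]; apply: HH. Qed.

Let r_T i (k : 'I_(ms i)) : r i (T k) = k.
Proof. by apply/esym/r_uniq; rewrite mulgV. Qed.

(** This is the cocycle identity theta(gh, t) = theta(g, t) theta(h, t^g). Both factors lie in
    [H i], which identifies the coset representative of the product and lets [f i] be applied
    factorwise. *)
Let data_split g h i (t : 'I_(ms i)) :
  let k := r i (mul (T t) g) in let l := r i (mul (T k) h) in
  mul (mul (T t) (mul g h)) (inv (T l)) =
  mul (mul (mul (T t) g) (inv (T k))) (mul (mul (T k) h) (inv (T l))).
Proof. by move=> k l; rewrite !mulA grp_mulKV. Qed.

Lemma data_outM g h x : data_out (mul g h) x = data_out h (data_out g x).
Proof.
rewrite /data_out /=; congr existT; apply/esym/r_uniq.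
by rewrite data_split; apply: HM.
Qed.

Lemma data_nxtM g h x :
  data_nxt (mul g h) x = mul (data_nxt g x) (data_nxt h (data_out g x)).
Proof.
rewrite /data_nxt; have := data_outM g h x; rewrite /data_out /= => /eqP.
by rewrite eq_Tagged => /eqP /= ->; rewrite data_split fM.
Qed.

Lemma data_out1 x : data_out one x = x.
Proof. by case: x => i t; rewrite /data_out /= mulg1 r_T. Qed.

Lemma data_nxt1 x : data_nxt one x = one.
Proof.
rewrite /data_nxt mulg1 r_T mulgV.
have := fM (H1 (tag x)) (H1 (tag x)); rewrite mulg1 => /(congr1 (mul (inv (f (tag x) one)))).
by rewrite mulA mulV mul1.
Qed.

Lemma data_out_inj g : injective (data_out g).
Proof.
apply: (can_inj (g := data_out (inv g))) => x.
by rewrite -data_outM mulgV data_out1.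
Qed.

Lemma data_runM g h w : run data_out data_nxt (mul g h) w =
  run data_out data_nxt h (run data_out data_nxt g w).
Proof. by elim: w g h => //= x w IH g h; rewrite data_outM data_nxtM IH. Qed.

Lemma data_run1 w : run data_out data_nxt one w = w.
Proof. by elim: w => //= x w IH; rewrite data_out1 data_nxt1 IH. Qed.

(** The kernel [K] of the action is normal, contained in every [H i] and invariant under every
    [f i], so simplicity makes it trivial. *)
Lemma data_run_faithful : simple_data mul one inv H f ->
  forall g h, run data_out data_nxt g =1 run data_out data_nxt h -> g = h.
Proof.
move=> simple.
pose K g := run data_out data_nxt g =1 id.
have KM g h : K g -> K h -> K (mul g h) by move=> Kg Kh w; rewrite data_runM Kg Kh.
have KV g : K g -> K (inv g).
  by move=> Kg w; rewrite -[in LHS](Kg w) -data_runM mulgV data_run1.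
have KJ g h : K g -> K (mul (inv h) (mul g h)).
  by move=> Kg w; rewrite !data_runM Kg -data_runM mulV data_run1.
have out_id g x : K g -> data_out g x = x by move=> /(_ [:: x]) [].
have K_T g i (t : 'I_(ms i)) : K g -> r i (mul (T t) g) = t.
  move=> Kg; move: (out_id g (Tagged (fun i => 'I_(ms i)) t) Kg) => /eqP.
  by rewrite /data_out eq_Tagged => /eqP.
(* The conjugate of g by [T t] lies in the kernel with g, so it fixes t, and its theta at t is g
   itself. Hence g lies in [H i], and [f i g] is a state of a kernel element. *)
have conjT g i (t : 'I_(ms i)) :
    mul (mul (T t) (mul (inv (T t)) (mul g (T t)))) (inv (T t)) = g.
  by rewrite grp_mulKVl grp_mulK.
have K1 g : K g -> g = one.
  apply: (simple K) => {g}.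
  - by split; [exact: data_run1 | split].
  (* Any index t would do; [r i one] shows that there is one. *)
  - move=> g Kg i; pose t := r i one.
    have := Hr i (mul (T t) (mul (inv (T t)) (mul g (T t)))).
    by rewrite K_T ?conjT //; apply: KJ.
  - by move=> g h; apply: KJ.
  - move=> i g Kg w; pose t := r i one.
    have K' := KJ g (T t) Kg; pose x : dletter ms := existT _ i t.
    have [_] := K' (x :: w); rewrite /data_nxt /= K_T // conjT; exact.
move=> g h E; have : mul g (inv h) = one.
  by apply: K1 => w; rewrite data_runM E -data_runM mulgV data_run1.
by move/(congr1 (mul^~ h)); rewrite grp_mulKV mul1.
Qed.

End DataMachine.

(** By faithfulness, finitely many states as maps on words means finitely many states as elements of
    G; [R g] lists these. *)
Lemma data_machine (G : Type) (mul : G -> G -> G) (one : G) (inv : G -> G) :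
    is_group mul one inv -> ss_finite_state_simple mul one inv ->
  exists (X : finType) (out : G -> X -> X) (nxt : G -> X -> G)
      (R : G -> seq G),
    [/\ forall g, injective (out g),
        forall g h x, out (mul g h) x = out h (out g x),
        forall g h x, nxt (mul g h) x = mul (nxt g x) (nxt h (out g x)),
        forall g h, run out nxt g =1 run out nxt h -> g = h &
        forall g u, List.In (reach nxt g u) (R g)].
Proof.
move=> gG [s [ms [H [f [T [r [Gd [simple [fs _]]]]]]]]].
exists (dletter ms), (data_out mul T r), (data_nxt mul inv f T r).
have faith := data_run_faithful gG Gd simple.
suff /choice[R HR] : forall g, exists Rg, forall u,
    List.In (reach (data_nxt mul inv f T r) g u) Rg.
  exists R; split=> //.
  - exact: (data_out_inj gG Gd).
  - exact: (data_outM gG Gd).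
  - exact: (data_nxtM gG Gd).
move=> g; have [_ [L HL]] := fs g.
(* [rep b] is the only group element that acts as [b], or [one] if there is none. *)
have /choice[rep repP] : forall b : seq (dletter ms) -> seq (dletter ms),
    exists h, forall h', run (data_out mul T r) (data_nxt mul inv f T r) h' =1 b ->
      h' = h.
  move=> b; have [[h hb]|no] :=
    pselect (exists h, run (data_out mul T r) (data_nxt mul inv f T r) h =1 b).
    by exists h => h' h'b; apply: faith => w; rewrite hb h'b.
  by exists one => h' h'b; case: no; exists h'.
exists (List.map rep L) => u; have [b Lb E] := HL u.
rewrite (repP b (reach _ g u)); first exact: List.in_map.
move=> w; rewrite -E -state_run /state; by rewrite dactE.
Qed.

(** * The wreath product *)

Section FiniteSum.
Variables (A : zmodType) (G : Type).

(** [{classic G}] gives the bare type [G] the classical equality and choice that finitely supported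
    sums require. *)
Definition fsum (F : G -> A) : A :=
  \sum_(h \in @classical_sets.setT {classic G}) F h.

Lemma fsumE (s : seq {classic G}) (F : G -> A) :
    uniq s -> (forall h : {classic G}, F h != 0 -> h \in s) ->
  fsum F = \sum_(h <- s) F h.
Proof.
move=> us Fs; rewrite /fsum (@fsbigE _ _ _ _ _ s) //.
  by apply: eq_bigl => h; rewrite in_setT.
by move=> h _; apply: contraNeq; apply: Fs.
Qed.

Lemma In_mem (T : eqType) (x : T) s : List.In x s -> x \in s.
Proof.
by elim: s => //= y s IH [->|/IH]; rewrite inE ?eqxx // => ->; rewrite orbT.
Qed.

Lemma finsupp_uniq (phi : G -> A) : finsupp phi ->
  exists2 s : seq {classic G}, uniq s &
    forall h : {classic G}, phi h != 0 -> h \in s.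
Proof.
move=> [l Hl]; exists (undup (l : seq {classic G})); first exact: undup_uniq.
by move=> h /Hl Ih; rewrite mem_undup; apply: In_mem.
Qed.

Lemma finsupp_sub (F F' : G -> A) :
  finsupp F' -> (forall h, F h != 0 -> F' h != 0) -> finsupp F.
Proof. by move=> [l Hl] sub; exists l => h /sub /Hl. Qed.

Lemma fsumD (F1 F2 : G -> A) : finsupp F1 -> finsupp F2 ->
  fsum (fun h => F1 h + F2 h) = fsum F1 + fsum F2.
Proof.
move=> /finsupp_uniq[s1 _ H1] /finsupp_uniq[s2 _ H2].
have us := undup_uniq (s1 ++ s2).
rewrite !(@fsumE (undup (s1 ++ s2))) ?big_split // => h Fh;
  rewrite mem_undup mem_cat; apply/orP; [by right; apply: H2 | by left; apply: H1 |].
have [F10|/H1] := eqVneq (F1 h) 0; last by left.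
by right; apply: H2; move: Fh; rewrite F10 add0r.
Qed.

Lemma fsum_reindex (p : G -> G) (F : G -> A) :
  bijective p -> fsum F = fsum (F \o p).
Proof. exact: (@reindex_fsbigT _ _ _ {classic G} {classic G}). Qed.

End FiniteSum.

(** * The machine for the wreath product *)

Section Lamplighter.
Variables (G : Type) (mul : G -> G -> G) (one : G) (inv : G -> G).
Hypothesis gG : is_group mul one inv.
Variables (X : finType) (out : G -> X -> X) (nxt : G -> X -> G)
  (R : G -> seq G).
Hypothesis out_inj : forall g, injective (out g).
Hypothesis outM : forall g h x, out (mul g h) x = out h (out g x).
Hypothesis nxtM :
  forall g h x, nxt (mul g h) x = mul (nxt g x) (nxt h (out g x)).
Hypothesis faithful : forall g h, run out nxt g =1 run out nxt h -> g = h.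
Hypothesis reachR : forall g u, List.In (reach nxt g u) (R g).
Variables (A : zmodType) (J : finType) (d : J -> nat) (chi : A -> J -> int).
Hypothesis chiD :
  forall a b j, ((d j)%:Z %| chi (a + b) j - (chi a j + chi b j))%Z.
Hypothesis chi_sep :
  forall a b, (forall j, ((d j)%:Z %| chi a j - chi b j)%Z) -> a = b.

(* There are two reset letters, with the same effect, only to ensure that the
   alphabet has at least two letters. *)
Definition letter : finType := (X * X + bool + digit d)%type.
Definition query (x y : X) : letter := inl (inl (x, y)).
Definition reset (b : bool) : letter := inl (inr b).

(* c h holds the current state of h and whether h has matched all guesses so far;
   it is kept for all h in G, although only g and the support of phi matter. *)
Definition tracker := G -> G * bool.

(** The first digit freezes the sum over the surviving h and turns [Scan] into [Lit], which from
    then on moves digits only. [Scan] keeps [phi] because the sum is formed only at that moment. *)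
Inductive lamp_state :=
  | Scan of (G -> A) & G & tracker
  | Lit of (J -> int).

Definition lamp_value (phi : G -> A) (c : tracker) : A :=
  fsum (fun h => if (c h).2 then phi h else 0).

Definition lamp_out (t : lamp_state) (z : letter) : letter :=
  match t, z with
  | Scan phi g c, inl (inl (x, y)) => query (out (c g).1 x) y
  | Scan phi g c, inr l => inr (odo_out (chi (lamp_value phi c)) l)
  | Lit v, inr l => inr (odo_out v l)
  | _, _ => z
  end.

(** A reset restores the states but keeps the flags, so that successive queries accumulate
    conditions on h. *)
Definition lamp_nxt (t : lamp_state) (z : letter) : lamp_state :=
  match t, z with
  | Scan phi g c, inl (inl (x, y)) =>
      Scan phi g (fun h => (nxt (c h).1 x, (c h).2 && (out (c h).1 x == y)))
  | Scan phi g c, inl (inr _) => Scan phi g (fun h => (h, (c h).2))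
  | Scan phi g c, inr l => Lit (odo_nxt (chi (lamp_value phi c)) l)
  | Lit v, inr l => Lit (odo_nxt v l)
  | Lit v, _ => t
  end.

Definition lamp_init (phi : G -> A) (g : G) : lamp_state :=
  Scan phi g (fun h => (h, true)).

Local Notation lrun := (run lamp_out lamp_nxt).
Local Notation lreach := (reach lamp_nxt).

Lemma lamp_out_inj t : injective (lamp_out t).
Proof.
have inrI : injective (@inr (X * X + bool) (digit d)) by move=> ? ? [].
case: t => [phi g c|v] [[[x y]|b]|l] [[[x' y']|b']|l'] //=.
- by case=> /out_inj-> ->.
- by move/inrI/odo_out_inj->.
- by move/inrI/odo_out_inj->.
Qed.

(** * The homomorphism property *)

Lemma lit_runD v v1 v2 w : (forall j, ((d j)%:Z %| v j - (v1 j + v2 j))%Z) ->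
  lrun (Lit v) w = lrun (Lit v2) (lrun (Lit v1) w).
Proof.
elim: w v v1 v2 => //= -[z|l] w IH v v1 v2 H; first by rewrite (IH v v1 v2).
by rewrite (odo_outD _ H); congr (_ :: _); apply: IH; apply: odo_nxtD.
Qed.

Lemma finsupp_if phi (b : G -> bool) :
  finsupp phi -> finsupp (fun h => if b h then phi h else 0 : A).
Proof. by move=> fs; apply: finsupp_sub fs _ => h; case: ifP => //; rewrite eqxx. Qed.

Lemma finsupp_translate phi g :
  finsupp phi -> finsupp (fun h => phi (mul (inv g) h) : A).
Proof.
move=> [l Hl]; exists (List.map (mul g) l) => h /Hl Ih.
by rewrite -(grp_mulKVl gG g h); apply: List.in_map.
Qed.

(** The product contains [phi2] translated by [g1]. The substitution of g1 h for h undoes the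
    translation, and the hypothesis matches the flags of g1 h in [c] with those of h in [c2]. *)
Lemma lamp_valueM phi1 phi2 g1 (c c2 : tracker) :
    finsupp phi1 -> finsupp phi2 ->
    (forall h, (c (mul g1 h)).2 = (c2 h).2) ->
  lamp_value (wr_mulf mul inv phi1 g1 phi2) c
    = lamp_value phi1 c + lamp_value phi2 c2.
Proof.
move=> fs1 fs2 cE.
pose F2 h := if (c h).2 then phi2 (mul (inv g1) h) else 0.
have -> : lamp_value phi2 c2 = fsum F2.
  have bij : bijective (mul g1).
    by exists (mul (inv g1)) => h; [exact: grp_mulVK gG _ _ | exact: grp_mulKVl gG _ _].
  rewrite (fsum_reindex _ bij); congr fsum; apply: funext => h.
  by rewrite /F2 /= cE (grp_mulVK gG).
rewrite -fsumD; last 2 first.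
- exact: finsupp_if.
- exact/finsupp_if/finsupp_translate.
congr fsum; apply: funext => h; rewrite /F2 /wr_mulf.
by case: ifP; rewrite ?addr0.
Qed.

(* The second factor reads letters already moved by g1, so its copy of h is in
   step with the copy of g1 h in the product. *)
Lemma scan_runM phi1 g1 phi2 g2 (c c2 : tracker) w :
    finsupp phi1 -> finsupp phi2 ->
    (forall h, c (mul g1 h) = (mul (c g1).1 (c2 h).1, (c2 h).2)) ->
  lrun (Scan (wr_mulf mul inv phi1 g1 phi2) (mul g1 g2) c) w
    = lrun (Scan phi2 g2 c2) (lrun (Scan phi1 g1 c) w).
Proof.
move=> fs1 fs2; elim: w c c2 => //= -[[[x y]|b]|l] w IH c c2 cE /=.
- rewrite cE outM; congr (_ :: _); apply: IH => h.
  by rewrite /= !cE /= nxtM outM.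
- by congr (_ :: _); apply: IH => h; rewrite /= cE.
have chiE j : ((d j)%:Z %| chi (lamp_value (wr_mulf mul inv phi1 g1 phi2) c) j
    - (chi (lamp_value phi1 c) j + chi (lamp_value phi2 c2) j))%Z.
  by rewrite (lamp_valueM (c2 := c2)) // => h; rewrite cE.
by rewrite (odo_outD _ chiE); congr (_ :: _); apply/lit_runD/odo_nxtD.
Qed.

Lemma lamp_runM phi1 g1 phi2 g2 w : finsupp phi1 -> finsupp phi2 ->
  lrun (lamp_init (wr_mulf mul inv phi1 g1 phi2) (mul g1 g2)) w
    = lrun (lamp_init phi2 g2) (lrun (lamp_init phi1 g1) w).
Proof. by move=> fs1 fs2; apply: scan_runM. Qed.

(** * Finiteness of the set of states *)

Lemma lamp_value_ext phi (c c' : tracker) :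
  (forall h, phi h != 0 -> c h = c' h) -> lamp_value phi c = lamp_value phi c'.
Proof.
move=> E; congr fsum; apply: funext => h.
by have [->|/E->//] := eqVneq (phi h) 0; rewrite !if_same.
Qed.

Lemma scan_ext phi g (c c' : tracker) w :
    c g = c' g -> (forall h, phi h != 0 -> c h = c' h) ->
  lrun (Scan phi g c) w = lrun (Scan phi g c') w.
Proof.
elim: w c c' => //= -[[[x y]|b]|l] w IH c c' Eg E /=.
- by rewrite Eg; congr (_ :: _); apply: IH => [|h /E->]; rewrite /= ?Eg.
- by congr (_ :: _); apply: IH => [|h /E->]; rewrite /= ?Eg.
by rewrite (lamp_value_ext E).
Qed.

(** At each h the tracker takes finitely many values, a state of h paired with a flag, and only g
    and the finite support of [phi] count. *)
Lemma tracker_choice (phi : G -> A) (g : G) : finsupp phi ->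
  exists L : seq tracker, forall c : tracker,
    (forall h, exists u, (c h).1 = reach nxt h u) ->
    exists c', [/\ List.In c' L, c g = c' g &
      forall h, phi h != 0 -> c h = c' h].
Proof.
case/finsupp_uniq => s _ Hs.
pose R' (h : {classic G}) := List.flat_map (fun k => [:: (k, true); (k, false)]) (R h).
have [L HL] := finite_fun_choice R' (fun h => (h, true)) ((g : {classic G}) :: s).
exists L => c cR; have [h|c' Lc' E] := HL c.
  apply/List.in_flat_map; exists (c h).1; split; last first.
    by case: (c h) => k [] /=; [left | right; left].
  by have [u ->] := cR h.
exists c'; split=> //; first by apply: E; rewrite inE eqxx.
by move=> h /Hs hs; apply: E; rewrite inE hs orbT.
Qed.

Lemma lit_choice (C : nat) : exists L : seq (J -> int), forall v,
  (forall j, `|v j|%N <= C)%N -> List.In v L.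
Proof.
pose I : seq int := List.map (fun n => n%:Z - C%:Z) (iota 0 C.*2.+1).
have [L HL] := finite_fun_choice (fun _ : J => I) (fun=> 0) (enum J).
exists L => v vC; have [j|v' Lv' E] := HL v; last first.
  by have -> : v = v' by apply: funext => j; apply: E; rewrite mem_enum.
apply/List.in_map_iff; exists `|(v j + C%:Z)%R|%N; split; first by have := vC j; lia.
have: `|(v j + C%:Z)%R|%N \in iota 0 C.*2.+1.
  by rewrite mem_iota; have := vC j; lia.
elim: (iota _ _) => //= n s IH; rewrite inE => /orP[/eqP->|/IH]; [by left | by right].
Qed.

Lemma lamp_in_F phi g : finsupp phi ->
  in_F (run (out_rank lamp_out) (nxt_rank lamp_nxt) (lamp_init phi g)).
Proof.
move=> fs; have [LT HLT] := tracker_choice g fs.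
(* Every lamp value that can arise is already attained on [LT], so [C] bounds the initial values of
   the odometers, and the carries stay within it. *)
have [C HC] : exists C : nat, forall c', List.In c' LT ->
    forall j, (`|chi (lamp_value phi c') j| <= C)%N.
  elim: LT {HLT} => [|c LT [C HC]]; first by exists 0%N.
  exists (maxn C (\max_j `|chi (lamp_value phi c) j|)%N) => c' [<-|/HC C'] j.
    by rewrite leq_max (leq_bigmax (F := fun j => `|chi (lamp_value phi c) j|%N)) orbT.
  by rewrite leq_max C'.
have [LL HLL] := lit_choice C.
pose P t := match t with
  | Scan phi' g' c => [/\ phi' = phi, g' = g &
      forall h, exists u, (c h).1 = reach nxt h u]
  | Lit v => forall j, (`|v j| <= C)%N
  end.
apply: (@in_F_run _ _ _ _ _ _ P
  (List.map (Scan phi g) LT ++ List.map Lit LL)).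
- by move=> t; apply/out_rank_inj/lamp_out_inj.
- by split=> // h; exists [::].
- move=> t i; rewrite /nxt_rank; move: (enum_val i) => z.
  case: t => [phi' g' c|v]; case: z => [[[x y]|b]|l] //=.
  + case=> -> -> cR; split=> // h; have [u ->] := cR h.
    by exists (rcons u x); rewrite /reach foldl_rcons.
  + by case=> -> -> cR; split=> // h; exists [::].
  + case=> -> _ cR; apply: odo_nxt_bound => j.
    have [c' [Lc' _ /lamp_value_ext->]] := HLT c cR; exact: HC.
  + by apply: odo_nxt_bound.
case=> [phi' g' c [-> -> cR]|v vC].
  have [c' [Lc' Eg E]] := HLT c cR; exists (Scan phi g c').
    by apply/List.in_or_app; left; apply: List.in_map.
  by move=> w; rewrite !run_rankE (scan_ext _ Eg E).
exists (Lit v) => //; apply/List.in_or_app; right.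
exact/List.in_map/HLL.
Qed.

(** * Faithfulness of the action *)

Definition query_word (u v : seq X) : seq letter :=
  [seq query p.1 p.2 | p <- zip u v].

Lemma reach_query phi g (c : tracker) u v : size u = size v ->
  lreach (Scan phi g c) (query_word u v)
    = Scan phi g (fun h => (reach nxt (c h).1 u,
                            (c h).2 && (run out nxt (c h).1 u == v))).
Proof.
elim: u v c => [|x u IH] [|y v] c //=.
  by move=> _; congr Scan; apply: funext => h; rewrite eqxx andbT; case: (c h).
case=> /IH E; rewrite /lreach /= -/(lreach _ _) E; congr Scan.
by apply: funext => h /=; rewrite eqseq_cons andbA.
Qed.

(** Each k other than h0 is discarded by querying a word u on which k and h0 differ, with the image
    of u under h0 as guesses; the final reset prepares the next round. The word depends on neither
    [phi] nor [g], so it can test two elements at once. *)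
Lemma isolating_word (s : seq {classic G}) (h0 : {classic G}) :
  exists (w : seq letter) (c : tracker),
    [/\ forall phi g, lreach (lamp_init phi g) w = Scan phi g c,
        forall h, (c h).1 = h, (c h0).2 &
        {in s, forall h, h != h0 -> (c h).2 = false}].
Proof.
elim: s => [|k s [w [c [Ec c1 c0 cs]]]].
  by exists [::], (fun h => (h, true)); split.
have [k0|k0] := eqVneq k h0.
  exists w, c; split=> // h; rewrite inE => /orP[/eqP->|]; last exact: cs.
  by rewrite k0 eqxx.
have [u uk] : exists u, run out nxt k u <> run out nxt h0 u.
  by apply/existsNP => E; case/eqP: k0; apply: faithful => u; apply: contrapT (E u).
exists (w ++ query_word u (run out nxt h0 u) ++ [:: reset true]).
exists (fun h => (h, (c h).2 && (run out nxt h u == run out nxt h0 u))).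
split=> //.
- move=> phi g; rewrite /reach !foldl_cat -!/(lreach _ _) Ec reach_query ?size_run //=.
  by congr Scan; apply: funext => h; rewrite c1.
- by rewrite /= c0 eqxx.
move=> h; rewrite inE => /orP[/eqP->|hs] hh0 /=; first by rewrite (introF eqP uk) andbF.
by rewrite cs.
Qed.

Lemma scan_digits phi g c w :
  lrun (Scan phi g c) (map inr w)
    = map inr (run (@odo_out _ d) (@odo_nxt _ d) (chi (lamp_value phi c)) w).
Proof.
case: w => //= l w; congr (_ :: _); move: (odo_nxt _ l) => v.
by elim: w v => //= {}l w IH v; rewrite IH.
Qed.

Lemma run_reach_ext (S : Type) (Z : finType) (o : S -> Z -> Z) n (s t : S) u :
  run o n s =1 run o n t -> run o n (reach n s u) =1 run o n (reach n t u).
Proof. by move=> E w; rewrite -!state_run /state E. Qed.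

Lemma lamp_run_inj phi1 g1 phi2 g2 : finsupp phi1 -> finsupp phi2 ->
    lrun (lamp_init phi1 g1) =1 lrun (lamp_init phi2 g2) ->
  phi1 =1 phi2 /\ g1 = g2.
Proof.
move=> /finsupp_uniq[s1 _ H1] /finsupp_uniq[s2 _ H2] E; split; last first.
  apply: faithful => u.
  (* Whatever the guesses, [g] moves the first components of queries, so these determine it; the
     guess is taken equal to the letter queried. *)
  pose pr (z : letter) : option X := if z is inl (inl (x, _)) then Some x else None.
  have prE phi g (c : tracker) :
      map pr (lrun (Scan phi g c) [seq query x x | x <- u])
      = map Some (run out nxt (c g).1 u).
    by elim: u c => //= x u IH c; rewrite IH.
  have := congr1 (map pr) (E [seq query x x | x <- u]).
  by rewrite !prE => /inj_map; apply=> x y [].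
move=> h0; apply: chi_sep => j.
(* Isolating h0 within both supports at once makes the digits after [w] see exactly [phi1 h0] and
   [phi2 h0]. *)
have [w [c [Ec _ c0 cs]]] := isolating_word (s1 ++ s2) h0.
have val phi : (forall h : {classic G}, phi h != 0 -> h \in s1 ++ s2) ->
    lamp_value phi c = phi h0.
  move=> Hphi; rewrite /lamp_value (fsumE (s := [:: h0 : {classic G}])) //.
    by rewrite big_seq1 c0.
  move=> h; rewrite inE; case: ifP => [ch /Hphi /cs|_]; last by rewrite eqxx.
  by case: eqVneq => // _ /(_ isT); rewrite ch.
rewrite -(val phi1) => [|h /H1 hs]; last by rewrite mem_cat hs.
rewrite -(val phi2) => [|h /H2 hs]; last by rewrite mem_cat hs orbT.
apply: odo_run_inj => x.
have := run_reach_ext w E (map inr x); rewrite !Ec !scan_digits.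
by apply: inj_map => ? ? [].
Qed.

Lemma lamp_embedding : wreath_embeds_in_F A mul inv #|letter|.
Proof.
exists (fun phi g =>
  run (out_rank lamp_out) (nxt_rank lamp_nxt) (lamp_init phi g)).
split; first by move=> phi g; apply: lamp_in_F.
split=> phi1 g1 phi2 g2 fs1 fs2.
  move=> w; rewrite !run_rankE lamp_runM // -map_comp.
  congr (map _ (run _ _ _ _)); rewrite (eq_map (g := id)) ?map_id // => x.
  exact: enum_rankK.
by move=> E; apply: lamp_run_inj => //; apply: run_rank_inj E.
Qed.

Lemma card_letter : (2 <= #|letter|)%N.
Proof. by rewrite !card_sum card_bool; lia. Qed.

End Lamplighter.

Theorem theoremC (A : zmodType) (G : Type) (mul : G -> G -> G) (one : G)
  (inv : G -> G) :
  is_group mul one inv ->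
  fin_gen_zmod A ->
  non_torsion mul one ->
  ss_finite_state_simple mul one inv ->
  exists n : nat, (2 <= n)%N /\ wreath_embeds_in_F A mul inv n.
Proof.
move=> gG /fin_gen_separated[J [d [chi [chiD chi_sep]]]] _.
case/(data_machine gG) => X [out [nxt [R [out_inj outM nxtM faithful reachR]]]].
exists #|letter X d|; split; first exact: card_letter.
exact: (lamp_embedding gG out_inj outM nxtM faithful reachR chiD chi_sep).
Qed.
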